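(* Let $T$ be the total number of iterations of the log-barrier interior point algorithm described in the context, and for $t\in[T]$ let $r_t$ be the rank of the update of the approximate slack matrix (the number of columns of the update factors $V_1,V_2\in\mathbb{R}^{n\times r_t}$) in the $t$-th iteration. Then for every non-increasing vector $g\in\mathbb{R}_+^n$, $$\sum_{t=1}^T r_t\cdot g_{r_t}\ \le\ O\big(T\cdot\|g\|_2\cdot\log n\big),$$ where the implied constant is absolute (and a term with $r_t=0$ is $0$).
   Context: Algorithm. Let $n\ge2$, let $C,A_1,\dots,A_m\in\mathbb{R}^{n\times n}$ be symmetric with $A_1,\dots,A_m$ linearly independent, $b\in\mathbb{R}^m$, and let $\mathsf{A}\in\mathbb{R}^{m\times n^2}$ have rows $\mathrm{vec}[A_i]^\top$. For $y\in\mathbb{R}^m$ let $S(y)=\sum_iy_iA_i-C$; for $S\succ0$ let $H(S)=\mathsf{A}(S^{-1}\otimes S^{-1})\mathsf{A}^\top$, i.e. $H(S)_{ij}=\mathrm{tr}[S^{-1}A_iS^{-1}A_j]$; and let $g_\eta(y)_j=\eta b_j-\mathrm{tr}[S(y)^{-1}A_j]$. Fix $0<\epsilon_N\le0.01$, an accuracy $0<\epsilon\leq 0.01$ and $\epsilon_S=10^{-5}$. The algorithm starts with $\eta=\frac1{n+2}$, a point $y$ with $S(y)\succ0$ and $g_\eta(y)^\top H(S(y))^{-1}g_\eta(y)\le\epsilon_N^2$, and $S=\widetilde S=S(y)$. It performs $T=\frac{40}{\epsilon_N}\sqrt n\log(n/\epsilon)$ iterations, each doing the following: $\eta\leftarrow\eta(1+\frac{\epsilon_N}{20\sqrt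 n})$; $y\leftarrow y-H(\widetilde S)^{-1}g_\eta(y)$ (with the new $\eta$); $S^{\mathrm{new}}=S(y)$ for the new $y$; $\widetilde S\leftarrow\widetilde S^{\mathrm{new}}$, where $\widetilde S^{\mathrm{new}}$ is produced from $(S^{\mathrm{new}},\widetilde S)$ by the low-rank slack update below; $S\leftarrow S^{\mathrm{new}}$. Low-rank slack update of $(S^{\mathrm{new}},\widetilde S)$. Let $Z^{\mathrm{mid}}=(S^{\mathrm{new}})^{-1/2}\widetilde S(S^{\mathrm{new}})^{-1/2}-I=U\,\mathrm{diag}(\lambda)\,U^\top$ with $U$ orthogonal, and let $\pi$ be a permutation of $[n]$ with $|\lambda_{\pi(1)}|\ge\dots\ge|\lambda_{\pi(n)}|$. If $|\lambda_{\pi(1)}|\le\epsilon_S$, set $\widetilde S^{\mathrm{new}}=\widetilde S$ and $r_t=0$. Otherwise let $r$ be the smallest integer $1\le r\le n/2$ such that both $|\lambda_{\pi(2r)}|\le\epsilon_S$ and $|\lambda_{\pi(2r)}|\le(1-1/\log n)|\lambda_{\pi(r)}|$, and put $r_t=2r$; if no such $r$ exists put $r_t=n$. Define $\lambda^{\mathrm{new}}_{\pi(i)}=0$ for $i\le r_t$ and $\lambda^{\mathrm{new}}_{\pi(i)}=\lambda_{\pi(i)}$ for $i>r_t$, and set $\widetilde S^{\mathrm{new}}=\widetilde S+(S^{\mathrm{new}})^{1/2}U\,\mathrm{diag}(\lambda^{\mathrm{new}}-\lambda)\,U^\top(S^{\mathrm{new}})^{1/2}$; this update is written $V_1V_2^\top$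 with $V_1,V_2\in\mathbb{R}^{n\times r_t}$. *)

(* Defs.v *)
From HB Require Import structures.
From mathcomp Require Export all_boot all_order all_algebra all_fingroup.
From mathcomp Require Export classical_sets reals exp.

Set Implicit Arguments.
Unset Strict Implicit.
Unset Printing Implicit Defensive.

Import Order.TTheory GRing.Theory Num.Theory.
Local Open Scope ring_scope.

Section Matrices.
Context {R : realType}.

Definition posdefmx n (S : 'M[R]_n) : Prop :=
  S^T = S /\ forall x : 'cV[R]_n, x != 0 -> 0 < (x^T *m S *m x) 0 0.

Definition possemidefmx n (S : 'M[R]_n) : Prop :=
  S^T = S /\ forall x : 'cV[R]_n, 0 <= (x^T *m S *m x) 0 0.

(* The symmetric positive semidefinite square root; it exists (and is unique)
   exactly when S is positive semidefinite, and the junk value 0 is returned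
   otherwise.  *)
Definition sqrtmx n (S : 'M[R]_n) : 'M[R]_n :=
  xget 0 [set P : 'M[R]_n | possemidefmx P /\ P *m P = S]%classic.

(* Coordinates numbered from 1 to n; 0 for an index outside this range. *)
Definition coord1 n (v : 'rV[R]_n) (k : nat) : R :=
  \sum_(i < n | i.+1 == k) v 0 i.

Definition l2norm n (v : 'rV[R]_n) : R := Num.sqrt (\sum_(i < n) v 0 i ^+ 2).

End Matrices.

Section LowRankUpdate.
Context {R : realType} (n : nat).
Implicit Types (lam : 'rV[R]_n) (pi : 'S_n) (Snew St : 'M[R]_n).

Definition epsS : R := 10 ^- 5.

Definition decreasing_abs lam pi : Prop :=
  forall i j : 'I_n, (i <= j)%N -> `|lam 0 (pi j)| <= `|lam 0 (pi i)|.

(* Since coord1 numbers from 1, coord1 (col_perm pi lam) k is the paper's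
   lambda_(pi(k)). *)
Definition cut_ok lam pi (r : nat) : bool :=
  let mu k := `|coord1 (col_perm pi lam) k| in
  (mu r.*2 <= epsS) && (mu r.*2 <= (1 - (ln n%:R)^-1) * mu r).

(* iota 1 n./2 lists the integers 1 <= r <= n / 2 in increasing order. *)
Definition update_rank lam pi : nat :=
  if `|coord1 (col_perm pi lam) 1| <= epsS then 0%N
  else if [seq r <- iota 1 n./2 | cut_ok lam pi r] is r :: _ then r.*2
  else n.

(* The entry of index pi(i) is set to 0 for the first r values of i. *)
Definition truncate_spectrum lam pi (r : nat) : 'rV[R]_n :=
  \row_j (if ((pi^-1)%g j < r)%N then 0 else lam 0 j).

(* A relation and not a function: U, lam and pi are arbitrary as long as they
   diagonalize Zmid and sort its spectrum.  When r = 0 the correction term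
   vanishes, so that St' = St. *)
Definition slack_update Snew St (r : nat) (St' : 'M[R]_n) : Prop :=
  let P := sqrtmx Snew in
  let Zmid := invmx P *m St *m invmx P - 1%:M in
  exists (U : 'M[R]_n) lam pi,
    [/\ U *m U^T = 1%:M,
        Zmid = U *m diag_mx lam *m U^T,
        decreasing_abs lam pi,
        r = update_rank lam pi &
        St' = St + P *m U *m diag_mx (truncate_spectrum lam pi r - lam)
                     *m U^T *m P].

End LowRankUpdate.

Section InteriorPoint.
Context {R : realType} (n m : nat).
Variables (C : 'M[R]_n) (A : 'I_m -> 'M[R]_n) (b : 'cV[R]_m) (epsN : R).

Definition slack (y : 'cV[R]_m) : 'M[R]_n := \sum_(i < m) y i 0 *: A i - C.

Definition hessian (S : 'M[R]_n) : 'M[R]_m :=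
  \matrix_(i, j) \tr (invmx S *m A i *m invmx S *m A j).

Definition gradient (eta : R) (y : 'cV[R]_m) : 'cV[R]_m :=
  \col_j (eta * b j 0 - \tr (invmx (slack y) *m A j)).

Record ipm_state := IpmState {
  st_eta : R;
  st_y : 'cV[R]_m;
  st_S : 'M[R]_n;
  st_Stilde : 'M[R]_n }.

Definition ipm_init (s : ipm_state) : Prop :=
  let g := gradient (st_eta s) (st_y s) in
  [/\ st_eta s = (n + 2)%:R^-1,
      posdefmx (slack (st_y s)),
      (g^T *m invmx (hessian (slack (st_y s))) *m g) 0 0 <= epsN ^+ 2,
      st_S s = slack (st_y s) &
      st_Stilde s = slack (st_y s)].

Definition ipm_step (s : ipm_state) (r : nat) (s' : ipm_state) : Prop :=
  [/\ st_eta s' = st_eta s * (1 + epsN / (20 * Num.sqrt n%:R)),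
      st_y s' = st_y s - invmx (hessian (st_Stilde s))
                           *m gradient (st_eta s') (st_y s),
      st_S s' = slack (st_y s') &
      slack_update (st_S s') (st_Stilde s) r (st_Stilde s')].

(* s t is the state after t iterations; r t, for 1 <= t <= T, is the rank of
   the update made in iteration t. *)
Definition ipm_run (T : nat) (s : nat -> ipm_state) (r : nat -> nat) : Prop :=
  ipm_init (s 0%N) /\
  forall t : nat, (t < T)%N -> ipm_step (s t) (r t.+1) (s t.+1).

End InteriorPoint.

(* The number of iterations 40 / epsN * sqrt n * ln (n / eps), rounded up. *)
Definition ipm_iterations (R : realType) (n : nat) (epsN eps : R) : nat :=
  `|Num.ceil (40 / epsN * Num.sqrt n%:R * ln (n%:R / eps))|%N.

(* Main.v *)
Require Import Defs.
From mathcomp Require Import complex ring lra.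
Set Implicit Arguments.
Unset Strict Implicit.
Unset Printing Implicit Defensive.
Import Order.TTheory GRing.Theory Num.Theory.
Local Open Scope ring_scope.

(* The potential is Phi = \sum_i g_i |lambda|_[i], where |lambda|_[1] >= ... are
   the sorted absolute eigenvalues of S^(-1/2) St S^(-1/2) - 1.

   Everything is expressed in a frame of S, a matrix V with V^T S V = 1, in which
   V^T St V = 1 + diag lambda.  The Newton analysis shows by induction that the
   dual norm of the gradient stays below epsN, so that X = V^T (S' - S) V has
   Frobenius norm at most 1.08 epsN for the next slack S'.  If V' is a frame of
   S' and c = V^-1 V', then lambda'_i = \sum_j c_(j,i)^2 lambda_j + (c^T c - 1)_(i,i),
   and the matrix of the c_(j,i)^2 has row and column sums 1 up to errors whose
   l2 norm is O(|X|); hence Phi increases by at most |g|_2 when S moves to S'.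

   Truncating the r_t largest eigenvalues decreases Phi by at least a constant
   times r_t g_(r_t) / log n: the cutoff r fails below r_t / 2, so |lambda|_[r]
   has lost at most a factor (1 - 1/log n) at each of the O(log n) halvings
   from r down to 1, and |lambda|_[1] > epsS.  Since Phi starts at 0 and is
   nonnegative, summing over the iterations gives the bound. *)

(** * The Frobenius norm *)

(** Up to the factor [p], the gap [p * q - s ^+ 2] is a sum of squares; when [p] vanishes, so does
    every [a i]. *)
Lemma sum_cauchy_schwarz (R : realDomainType) (I : finType) (a b : I -> R) :
  (\sum_i a i * b i) ^+ 2 <= (\sum_i a i ^+ 2) * (\sum_i b i ^+ 2).
Proof.
set s := \sum_i _ * _; set p := \sum_i a i ^+ 2; set q := \sum_i b i ^+ 2.
have p_ge0 : 0 <= p by apply: sumr_ge0 => i _; apply: sqr_ge0.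
have key : 0 <= p * (p * q - s ^+ 2).
  have -> : p * (p * q - s ^+ 2) = \sum_i (p * b i - s * a i) ^+ 2.
    under eq_bigr => i _.
      have -> : (p * b i - s * a i) ^+ 2 =
        p ^+ 2 * b i ^+ 2 - (p * s) *+ 2 * (a i * b i) + s ^+ 2 * a i ^+ 2.
        by ring.
      over.
    rewrite big_split sumrB /= -!mulr_sumr -/s -/p -/q; ring.
  by apply: sumr_ge0 => i _; apply: sqr_ge0.
have [p0|p_neq0] := eqVneq p 0; last first.
  by move: key; rewrite pmulr_rge0 ?subr_ge0 // lt0r p_neq0.
have a0 i : a i = 0.
  apply/eqP; rewrite -sqrf_eq0; move/eqP: p0.
  by rewrite psumr_eq0 => [/allP/(_ i)|j _]; rewrite ?mem_index_enum ?sqr_ge0; auto.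
rewrite p0 mul0r /s big1 ?expr0n // => i _; by rewrite a0 mul0r.
Qed.

Section Frobenius.
Context {R : realType} {n : nat}.
Implicit Types (X Y Z : 'M[R]_n).

Definition fdot X Y : R := \tr (X *m Y^T).
Definition fnorm X : R := Num.sqrt (fdot X X).

Lemma fdotE X Y : fdot X Y = \sum_i \sum_j X i j * Y i j.
Proof.
by apply: eq_bigr => i _; rewrite mxE; apply: eq_bigr => j _; rewrite mxE.
Qed.

Lemma fdotEp X Y : fdot X Y = \sum_(p : 'I_n * 'I_n) X p.1 p.2 * Y p.1 p.2.
Proof. by rewrite fdotE pair_bigA. Qed.

Lemma fdotC X Y : fdot X Y = fdot Y X.
Proof. by rewrite !fdotEp; apply: eq_bigr => i _; rewrite mulrC. Qed.

Lemma fdotDl X Y Z : fdot (X + Y) Z = fdot X Z + fdot Y Z.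
Proof. by rewrite /fdot mulmxDl linearD. Qed.

Lemma fdotDr X Y Z : fdot Z (X + Y) = fdot Z X + fdot Z Y.
Proof. by rewrite fdotC fdotDl !(fdotC Z). Qed.

Lemma fdotNl X Z : fdot (- X) Z = - fdot X Z.
Proof. by rewrite /fdot mulNmx linearN. Qed.

Lemma fdotNr X Z : fdot Z (- X) = - fdot Z X.
Proof. by rewrite fdotC fdotNl fdotC. Qed.

Lemma fdot_ge0 X : 0 <= fdot X X.
Proof. by rewrite fdotEp; apply: sumr_ge0 => i _; rewrite -expr2 sqr_ge0. Qed.

Lemma fnorm_ge0 X : 0 <= fnorm X.
Proof. exact: sqrtr_ge0. Qed.

Lemma sqr_fnorm X : fnorm X ^+ 2 = fdot X X.
Proof. by rewrite sqr_sqrtr ?fdot_ge0. Qed.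

Lemma fnormE X : fnorm X ^+ 2 = \sum_i \sum_j X i j ^+ 2.
Proof. by rewrite sqr_fnorm fdotE; do 2 (apply: eq_bigr => ? _). Qed.

Lemma fnorm_eq0 X : fnorm X = 0 -> X = 0.
Proof.
move=> X0; apply/matrixP => i j; rewrite mxE; apply/eqP; rewrite -sqrf_eq0.
have : fnorm X ^+ 2 == 0 by rewrite X0 expr0n.
rewrite sqr_fnorm fdotEp psumr_eq0 => [/allP/(_ (i, j))|p _].
  by rewrite mem_index_enum -expr2; auto.
by rewrite -expr2 sqr_ge0.
Qed.

Lemma fdot_le X Y : `|fdot X Y| <= fnorm X * fnorm Y.
Proof.
rewrite -ler_sqr ?nnegrE ?mulr_ge0 ?fnorm_ge0 // real_normK ?num_real //.
rewrite exprMn !sqr_fnorm !fdotEp.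
exact: (@sum_cauchy_schwarz R _ (fun p => X p.1 p.2) (fun p => Y p.1 p.2)).
Qed.

Lemma fnormD X Y : fnorm (X + Y) <= fnorm X + fnorm Y.
Proof.
rewrite -ler_sqr ?nnegrE ?addr_ge0 ?fnorm_ge0 //.
rewrite sqr_fnorm fdotDl !fdotDr -!sqr_fnorm (fdotC Y).
have := le_trans (ler_norm _) (fdot_le X Y); nra.
Qed.

Lemma fnormN X : fnorm (- X) = fnorm X.
Proof. by rewrite /fnorm fdotNl fdotNr opprK. Qed.

Lemma fnormB X Y : fnorm (X - Y) <= fnorm X + fnorm Y.
Proof. by rewrite -(fnormN Y) fnormD. Qed.

Lemma fnormT X : fnorm X^T = fnorm X.
Proof. by rewrite /fnorm /fdot trmxK mxtrace_mulC. Qed.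

Lemma fnormM X Y : fnorm (X *m Y) <= fnorm X * fnorm Y.
Proof.
rewrite -ler_sqr ?nnegrE ?mulr_ge0 ?fnorm_ge0 // exprMn !fnormE.
rewrite mulr_suml; apply: ler_sum => i _.
rewrite (exchange_big _ _ _ _ _ (fun i j => Y i j ^+ 2)) mulr_sumr /=.
apply: ler_sum => j _; rewrite mxE.
exact: (@sum_cauchy_schwarz R _ (X i) (fun k => Y k j)).
Qed.

Lemma fnorm_le_entries (k : R) X Y : 0 <= k ->
  (forall i j, `|Y i j| <= k * `|X i j|) -> fnorm Y <= k * fnorm X.
Proof.
move=> k0 XY; rewrite -ler_sqr ?nnegrE ?mulr_ge0 ?fnorm_ge0 //.
rewrite exprMn !fnormE mulr_sumr; apply: ler_sum => i _.
rewrite mulr_sumr; apply: ler_sum => j _.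
by rewrite -(real_normK (num_real (Y i j))) -(real_normK (num_real (X i j)))
  -exprMn ler_sqr ?nnegrE ?mulr_ge0.
Qed.

Lemma fnorm1 : fnorm 1%:M = Num.sqrt n%:R.
Proof. by rewrite /fnorm /fdot trmx1 mulmx1 mxtrace1. Qed.

(* Both squared norms are tr((c^T c)^2) - 2 tr(c^T c) + n. *)
Lemma fnorm_gram (c : 'M[R]_n) :
  fnorm (c *m c^T - 1%:M) = fnorm (c^T *m c - 1%:M).
Proof.
have expand Y : fdot (Y - 1%:M) (Y - 1%:M) = \tr (Y *m Y^T) - \tr Y *+ 2 + n%:R.
  rewrite !(fdotDl, fdotDr, fdotNl, fdotNr) /fdot trmx1 !(mulmx1, mul1mx).
  by rewrite mxtrace_tr mxtrace1 opprK mulr2n opprD !addrA.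
rewrite /fnorm !expand !trmx_mul !trmxK !mulmxA.
by rewrite -(mulmxA _ c c^T) -(mulmxA c) !(mxtrace_mulC c) !mulmxA.
Qed.

Lemma sum_diag_sqr X : \sum_i X i i ^+ 2 <= fnorm X ^+ 2.
Proof.
rewrite fnormE; apply: ler_sum => i _; rewrite (bigD1 i) //= lerDl.
by apply: sumr_ge0 => j _; apply: sqr_ge0.
Qed.

(** The quadratic form is the Frobenius product of [X] with x x^T, whose norm is |x|^2. *)
Lemma quadform_le X (x : 'cV[R]_n) :
  `|(x^T *m X *m x) 0 0| <= fnorm X * (x^T *m x) 0 0.
Proof.
have -> : (x^T *m X *m x) 0 0 = fdot X (x *m x^T).
  by rewrite /fdot trmx_mul trmxK mulmxA mxtrace_mulC mulmxA trace_mx11.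
apply: le_trans (fdot_le _ _) _; rewrite ler_wpM2l ?fnorm_ge0 //.
have x0 : 0 <= (x^T *m x) 0 0.
  by rewrite mxE; apply: sumr_ge0 => i _; rewrite mxE -expr2 sqr_ge0.
rewrite -ler_sqr ?nnegrE ?fnorm_ge0 // sqr_fnorm /fdot trmx_mul trmxK.
rewrite mulmxA mxtrace_mulC !mulmxA -(mulmxA _ x^T) trace_mx11.
by rewrite [leLHS]mxE big_ord1 expr2.
Qed.

End Frobenius.

(** * Square roots of positive semidefinite matrices *)

(** As in Newton interpolation, each new node adds a multiple of the polynomial [w] that vanishes at
    the earlier nodes. *)
Lemma poly_interpolation (F : fieldType) (f : F -> F) (s : seq F) :
  exists q : {poly F}, forall x, x \in s -> q.[x] = f x.
Proof.
elim: s => [|a s [q qf]]; first by exists 0.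
have [as_|a_s] := boolP (a \in s).
  by exists q => x; rewrite inE => /orP[/eqP->|]; apply: qf.
pose w := \prod_(y <- s) ('X - y%:P).
have wa : w.[a] != 0.
  by move: a_s; rewrite -(root_prod_XsubC s a) /root.
exists (q + ((f a - q.[a]) / w.[a]) *: w) => x.
rewrite inE !hornerE => /orP[/eqP->|xs]; first by rewrite divfK // subrKC.
have /eqP-> : root w x by rewrite root_prod_XsubC.
by rewrite mulr0 addr0 qf.
Qed.

Lemma trmx_horner_mx (F : comNzRingType) n (S : 'M[F]_n.+1) (q : {poly F}) :
  (horner_mx S q)^T = horner_mx S^T q.
Proof.
elim/poly_ind: q => [|p c IH]; first by rewrite !rmorph0 trmx0.
rewrite !(rmorphD, rmorphM) /= !horner_mx_X !horner_mx_C linearD /=.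
rewrite tr_scalar_mx trmx_mul IH; congr (_ + _).
by apply: comm_mx_horner.
Qed.

Lemma horner_mx_diagonalized (F : fieldType) n (P : 'M[F]_n.+1) d q :
    P \in unitmx ->
  horner_mx (invmx P *m diag_mx d *m P) q
    = invmx P *m diag_mx (map_mx (horner q) d) *m P.
Proof. by move=> Pu; rewrite horner_mx_uconjC // horner_mx_diag. Qed.

Local Open Scope sesquilinear_scope.
Local Open Scope complex_scope.

(* Interpolating the fourth root on the spectrum of S by a real polynomial q
   makes Q = q(S) real and symmetric, so Q^2 is a positive semidefinite square
   root of S. *)
Lemma psd_fourth_root (R : rcfType) n (S : 'M[R]_n.+1) : S^T = S ->
    (forall x : 'cV[R]_n.+1, 0 <= (x^T *m S *m x) 0 0) ->
  exists Q : 'M[R]_n.+1, Q^T = Q /\ Q ^+ 4 = S.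
Proof.
move=> Ssym Spsd; pose toC := real_complex R.
pose Sc := map_mx toC S.
have ScH : Sc \is hermsymmx.
  apply/is_hermitianmxP; rewrite expr0 scale1r; apply/matrixP => i j.
  by rewrite !mxE /= -{1}Ssym mxE; apply/esym/conjc_real.
pose P := spectralmx Sc; pose d := spectral_diag Sc.
have /orthomx_spectralP ScE := hermitian_normalmx ScH.
pose e i : R := complex.Re (d 0 i).
have dE i : d 0 i = (e i)%:C.
  have /mxOverP/(_ 0 i) := hermitian_spectral_diag_real ScH.
  by move=> /complex_realP[x dx]; rewrite /e -/d in dx *; rewrite dx.
have e_ge0 i : 0 <= e i.
  have dP : P *m Sc *m P^t* = diag_mx d.
    rewrite -invmx_unitary ?spectral_unitarymx // [Sc]ScE !mulmxA.
    by rewrite mulmxV ?spectral_unit // mul1mx mulmxK ?spectral_unit.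
  (* The diagonal entry is the Hermitian form of [S] at row [i] of [P]; its real part is the sum of
     the quadratic forms at the real and imaginary parts of that row. *)
  pose x : 'cV[R]_n.+1 := \col_j complex.Re (P i j).
  pose y : 'cV[R]_n.+1 := \col_j complex.Im (P i j).
  suff -> : e i = (x^T *m S *m x) 0 0 + (y^T *m S *m y) 0 0 by rewrite addr_ge0.
  have -> : e i = complex.Re ((P *m Sc *m P^t*) i i) by rewrite dP mxE eqxx.
  rewrite !mxE -big_split raddf_sum /=; apply: eq_bigr => j _.
  rewrite !mxE !mulr_suml raddf_sum -big_split /=; apply: eq_bigr => k _.
  rewrite !mxE.
  case: (P i k) (P i j) => [a b] [c z] /=; ring.
have [q qe] := @poly_interpolation _ (fun x => Num.sqrt (Num.sqrt x))
  [seq e i | i : 'I_n.+1].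
exists (horner_mx S q); split; first by rewrite trmx_horner_mx Ssym.
have qd : map_mx (horner (map_poly toC (q ^+ 4))) d = d.
  apply/rowP => i; rewrite mxE dE horner_map /= horner_exp qe ?map_f ?mem_enum //.
  by rewrite (exprM _ 2 2) !sqr_sqrtr ?sqrtr_ge0.
apply: (@map_mx_inj _ _ toC).
rewrite -rmorphXn /= map_horner_mx -/Sc [in LHS]ScE.
by rewrite (horner_mx_diagonalized _ _ (spectral_unit Sc)) qd -ScE.
Qed.

Local Close Scope complex_scope.
Local Close Scope sesquilinear_scope.

(** The square of the fourth root [Q] is a witness, so [xget] does not return its default value. *)
Lemma sqrtmxP (R : realType) n (S : 'M[R]_n) : possemidefmx S ->
  possemidefmx (sqrtmx S) /\ sqrtmx S *m sqrtmx S = S.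
Proof.
move=> [Ssym Spsd].
suff [P PS] : exists P : 'M[R]_n, possemidefmx P /\ P *m P = S.
  by rewrite /sqrtmx; case: xgetP => [_ -> //|/(_ P)].
(* Evaluating polynomials at matrices requires a positive size, so size 0 is treated apart. *)
case: n S Ssym Spsd => [|n] S Ssym Spsd.
  exists 0; split; last by apply/matrixP => -[].
  by split=> [|x]; rewrite ?trmx0 // mulmx0 mul0mx mxE.
have [Q [Qsym QS]] := psd_fourth_root Ssym Spsd.
exists (Q *m Q); split; last by rewrite -QS (exprM _ 2 2) expr2.
split=> [|x]; first by rewrite trmx_mul Qsym.
have -> : x^T *m (Q *m Q) *m x = (Q *m x)^T *m (Q *m x).
  by rewrite trmx_mul Qsym !mulmxA.
by rewrite mxE; apply: sumr_ge0 => i _; rewrite mxE -expr2 sqr_ge0.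
Qed.

(** * Frames and the Hessian *)

Section Frames.
Context {R : realType} {n : nat}.
Implicit Types (S V X : 'M[R]_n).

(** For positive definite [S] the frames are the matrices S^(-1/2) U with U orthogonal; the freedom
    in U allows a basis that diagonalizes the approximate slack. *)
Definition is_frame V S : Prop := V^T *m S *m V = 1%:M.

Lemma frame_unit V S : is_frame V S -> V \in unitmx.
Proof. by move=> /mulmx1_unit[]. Qed.

Lemma congr_unitmx V S X : V \in unitmx -> V^T *m S *m V = X ->
  S = (invmx V)^T *m X *m invmx V.
Proof.
move=> Vu <-; rewrite -!mulmxA mulmxV // mulmx1 mulmxA -trmx_mul.
by rewrite mulmxV // trmx1 mul1mx.
Qed.

Lemma frameE V S : is_frame V S -> S = (invmx V)^T *m invmx V.
Proof.
by move=> fr; rewrite {1}(congr_unitmx (frame_unit fr) fr) mulmx1.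
Qed.

Lemma frame_inv V S : is_frame V S -> invmx S = V *m V^T.
Proof.
move=> fr; have Vu := frame_unit fr.
have SV : S *m (V *m V^T) = 1%:M.
  rewrite (frameE fr) mulmxA mulmxKV // -trmx_mul.
  by rewrite mulmxV // trmx1.
have [Su _] := mulmx1_unit SV.
by rewrite -[LHS]mulmx1 -SV mulKmx.
Qed.

(** The form of [S] at [x] is at least (1 - |X|) |V^-1 x|^2, hence definite. This keeps the next
    slack in the cone where [sqrtmx] is a genuine root. *)
Lemma psd_congr V S X : V \in unitmx -> V^T *m S *m V = 1%:M + X ->
  X^T = X -> fnorm X < 1 -> possemidefmx S /\ S \in unitmx.
Proof.
move=> Vu VSV Xsym X1; have SE := congr_unitmx Vu VSV.
have quad (x : 'cV[R]_n) : (1 - fnorm X) * ((invmx V *m x)^T *m (invmx V *m x)) 0 0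
    <= (x^T *m S *m x) 0 0.
  have -> : x^T *m S *m x = (invmx V *m x)^T *m (invmx V *m x)
      + (invmx V *m x)^T *m X *m (invmx V *m x).
    by rewrite SE trmx_mul -!mulmxA -!mulmxDr mulmxDl mul1mx.
  rewrite [leRHS]mxE; have := quadform_le X (invmx V *m x).
  rewrite ler_norml => /andP[+ _]; lra.
have sq0 (x : 'cV[R]_n) : 0 <= (x^T *m x) 0 0.
  by rewrite mxE; apply: sumr_ge0 => i _; rewrite mxE -expr2 sqr_ge0.
have X0 : 0 < 1 - fnorm X by rewrite subr_gt0.
split.
  split=> [|x]; last by apply: le_trans (quad x); rewrite mulr_ge0 // ltW.
  by rewrite SE !trmx_mul trmxK linearD /= Xsym trmx1 mulmxA.
rewrite unitmxE unitfE; apply/det0P => -[v v0 vS].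
have := quad v^T; rewrite trmxK vS mul0mx [leRHS]mxE pmulr_rle0 // => vV.
have {}vV : ((invmx V *m v^T)^T *m (invmx V *m v^T)) 0 0 = 0.
  by apply/le_anti; rewrite vV sq0.
have Vv0 : invmx V *m v^T = 0.
  apply/colP => i; rewrite [RHS]mxE; apply/eqP; rewrite -sqrf_eq0.
  move/eqP: vV; rewrite mxE psumr_eq0 => [/allP/(_ i)|j _].
    by rewrite mem_index_enum mxE -expr2; auto.
  by rewrite mxE -expr2 sqr_ge0.
move: v0; rewrite -(inj_eq trmx_inj) trmx0.
by rewrite -(mulKVmx Vu v^T) Vv0 mulmx0 eqxx.
Qed.

Lemma sqrtmx_frame S (U : 'M[R]_n) : possemidefmx S -> S \in unitmx ->
    U *m U^T = 1%:M ->
  [/\ (sqrtmx S)^T = sqrtmx S, sqrtmx S \in unitmx &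
      is_frame (invmx (sqrtmx S) *m U) S].
Proof.
move=> psd Su UU; have [[Psym _] PP] := sqrtmxP psd.
have Pu : sqrtmx S \in unitmx.
  by move: Su; rewrite -{1}PP unitmx_mul => /andP[].
split=> //; rewrite /is_frame trmx_mul trmx_inv Psym -{2}PP.
rewrite !mulmxA mulmxKV // mulmxK //.
exact: mulmx1C.
Qed.

Lemma posdef_psd_unit S : posdefmx S -> possemidefmx S /\ S \in unitmx.
Proof.
move=> [Ssym Spd]; split.
  split=> // x; have [->|/Spd/ltW//] := eqVneq x 0.
  by rewrite mulmx0 mxE.
rewrite unitmxE unitfE; apply/det0P => -[v v0 vS].
have vT0 : v^T != 0 by rewrite -(inj_eq trmx_inj) trmxK trmx0.
by have := Spd _ vT0; rewrite trmxK vS mul0mx mxE ltxx.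
Qed.

End Frames.

(** * The Hessian as a Gram matrix in a frame *)

Section Hessian.
Context {R : realType} {n m : nat} (A : 'I_m -> 'M[R]_n).
Hypothesis Asym : forall i, (A i)^T = A i.
Hypothesis Afree : free [tuple A i | i < m].

(** The linear part of the affine map [slack]. *)
Definition comb (u : 'cV[R]_m) : 'M[R]_n := \sum_(i < m) u i 0 *: A i.

Lemma comb_sym u : (comb u)^T = comb u.
Proof.
by rewrite /comb linear_sum; apply: eq_bigr => i _; rewrite linearZ /= Asym.
Qed.

Lemma combB u w : comb (u - w) = comb u - comb w.
Proof.
rewrite /comb -sumrB; apply: eq_bigr => i _.
by rewrite !mxE scalerBl.
Qed.

Lemma comb_eq0 u : comb u = 0 -> u = 0.
Proof.
move=> u0; apply/colP => i; rewrite mxE.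
have /freeP/(_ (fun j => u j 0)) := Afree; apply.
by rewrite -[RHS]u0; apply: eq_bigr => j _; rewrite -tnth_nth tnth_mktuple.
Qed.

(** The adjoint of [comb] for the trace pairing. *)
Definition trace_vec (M : 'M[R]_n) : 'cV[R]_m := \col_j \tr (M *m A j).

Lemma trace_vec_dot M u : ((trace_vec M)^T *m u) 0 0 = \tr (M *m comb u).
Proof.
rewrite mxE /comb mulmx_sumr linear_sum; apply: eq_bigr => j _.
by rewrite !mxE -scalemxAr linearZ /= mulrC.
Qed.

Variables (V S : 'M[R]_n).
Hypothesis frVS : is_frame V S.

(** The direction [comb u] in the coordinates of [V]. When [V] is a frame of [S], its Frobenius norm
    is the norm of [u] for the Hessian at [S]. *)
Definition in_frame u := V^T *m comb u *m V.

Lemma in_frame_sym u : (in_frame u)^T = in_frame u.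
Proof. by rewrite /in_frame !trmx_mul trmxK comb_sym mulmxA. Qed.

Lemma in_frame_eq0 u : fnorm (in_frame u) = 0 -> u = 0.
Proof.
move=> /fnorm_eq0 /(congr_unitmx (frame_unit frVS)) u0.
by apply: comb_eq0; rewrite u0 mulmx0 mul0mx.
Qed.

(** Substituting V V^T for S^-1 and permuting cyclically under the trace turns the Hessian form into
    a Frobenius product. *)
Lemma hessian_frame u w :
  (u^T *m hessian A S *m w) 0 0 = fdot (in_frame u) (in_frame w).
Proof.
have -> : u^T *m hessian A S = (trace_vec (invmx S *m comb u *m invmx S))^T.
  apply/rowP => j; rewrite !mxE /comb mulmx_sumr !mulmx_suml linear_sum.
  apply: eq_bigr => i _; rewrite !mxE.
  by rewrite -scalemxAr -!scalemxAl linearZ.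
rewrite trace_vec_dot (frame_inv frVS) /fdot in_frame_sym /in_frame.
by rewrite !mulmxA -!(mulmxA V) mxtrace_mulC -!mulmxA.
Qed.

Lemma hessian_unit : hessian A S \in unitmx.
Proof.
rewrite unitmxE unitfE; apply/det0P => -[v v0 vH].
have := hessian_frame v^T v^T; rewrite trmxK vH mul0mx mxE.
rewrite -sqr_fnorm => /esym/eqP; rewrite sqrf_eq0 => /eqP /in_frame_eq0 /eqP.
by rewrite -(inj_eq trmx_inj) trmxK trmx0 (negPf v0).
Qed.

Lemma hessian_sym : (hessian A S)^T = hessian A S.
Proof.
apply/matrixP => i j; rewrite !mxE -mulmxA mxtrace_mulC -!mulmxA.
by rewrite mxtrace_mulC !mulmxA mxtrace_mulC !mulmxA.
Qed.

(** Cauchy-Schwarz against w = H^-1 g, whose squared norm is g^T H^-1 g. Testing against all [u]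
    frees the bound from the inverse Hessian, so that it can be carried from one iterate to the
    next. *)
Lemma hessian_dual_norm (g : 'cV[R]_m) (e : R) : 0 <= e ->
    (g^T *m invmx (hessian A S) *m g) 0 0 <= e ^+ 2 ->
  forall u, `|(g^T *m u) 0 0| <= e * fnorm (in_frame u).
Proof.
move=> e0 ge u; pose w := invmx (hessian A S) *m g.
have gw : g^T = w^T *m hessian A S.
  by rewrite -hessian_sym -trmx_mul mulKVmx ?hessian_unit.
rewrite gw hessian_frame; apply: le_trans (fdot_le _ _) _.
rewrite ler_wpM2r ?fnorm_ge0 // -ler_sqr ?nnegrE ?fnorm_ge0 //.
rewrite sqr_fnorm -hessian_frame -gw; apply: le_trans ge.
by rewrite -mulmxA.
Qed.

End Hessian.

(** * Passing from a frame of one slack matrix to a frame of the next *)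

Section FrameChange.
Context {R : realType} {n : nat} (S S' V V' X : 'M[R]_n).
Hypothesis fr : is_frame V S.
Hypothesis fr' : is_frame V' S'.
Hypothesis VSV : V^T *m S' *m V = 1%:M + X.

Let c := invmx V *m V'.
Let J := c *m c^T.

Lemma frame_change_mul : V *m c = V'.
Proof. by rewrite mulKVmx // (frame_unit fr). Qed.

(** [J] is S'^-1 in the coordinates of [V], because V' V'^T = S'^-1. *)
Lemma frame_change_inv : (1%:M + X) *m J = 1%:M.
Proof.
have Vu := frame_unit fr.
rewrite -VSV /J {1}/c !mulmxA mulmxK // trmx_mul -mulmxA mulmxA.
rewrite -(mulmxA _ V') (frameE fr') -mulmxA.
have V'u := frame_unit fr'.
rewrite !mulmxA -(mulmxA _ (invmx V') V') mulVmx // mulmx1.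
rewrite -(mulmxA V^T) -trmx_mul mulmxV // trmx1 mulmx1.
by rewrite -trmx_mul mulVmx // trmx1.
Qed.

Lemma frame_change_subJ : 1%:M - J = X *m J.
Proof. by rewrite -frame_change_inv mulmxDl mul1mx addrC addKr. Qed.

Hypothesis X_small : fnorm X <= 1 / 50.

(** From XJ = X - X(XJ) follows |XJ| <= |X| + |X| |XJ|, and 1 / (1 - 1/50) is below 26/25. *)
Lemma fnorm_XJ : fnorm (X *m J) <= 26 / 25 * fnorm X.
Proof.
have XJ : X *m J = X - X *m (X *m J).
  by rewrite -[in RHS]frame_change_subJ mulmxBr mulmx1 opprB subrKC.
have := fnormB X (X *m (X *m J)); rewrite -XJ.
have := fnormM X (X *m J); have := fnorm_ge0 X; have := fnorm_ge0 (X *m J).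
move: X_small; nra.
Qed.

Lemma fnorm_frame_gram : fnorm (c^T *m c - 1%:M) <= 26 / 25 * fnorm X.
Proof.
by rewrite -fnorm_gram -fnormN opprB frame_change_subJ fnorm_XJ.
Qed.

(** With d = V'^-1 V the left matrix is d^T B d. Its squared norm is the Frobenius product of d d^T
    B with its transpose, and d d^T differs from 1 by a matrix of norm |X|, which gives the factor 1
    + |X|. *)
Lemma fnorm_frame_change (M : 'M[R]_n) : M^T = M ->
  fnorm (V^T *m M *m V) <= (1 + fnorm X) * fnorm (V'^T *m M *m V').
Proof.
move=> Msym; pose d := invmx V' *m V; set B := V'^T *m M *m V'.
have Bsym : B^T = B by rewrite /B !trmx_mul trmxK Msym mulmxA.
have -> : V^T *m M *m V = d^T *m B *m d.
  have <- : V' *m d = V by rewrite mulKVmx // (frame_unit fr').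
  by rewrite /B trmx_mul !mulmxA.
clearbody B.
have dd : fnorm (d *m d^T - 1%:M) = fnorm X.
  rewrite fnorm_gram; congr fnorm; apply: (addrI 1%:M); rewrite subrKC -VSV.
  by rewrite (frameE fr') /d trmx_mul !mulmxA.
clearbody d.
have MB : fnorm (d *m d^T *m B) <= (1 + fnorm X) * fnorm B.
  have -> : d *m d^T *m B = B + (d *m d^T - 1%:M) *m B.
    by rewrite mulmxBl mul1mx subrKC.
  apply: le_trans (fnormD _ _) _; rewrite mulrDl mul1r lerD2l -dd.
  exact: fnormM.
apply: le_trans MB; rewrite -ler_sqr ?nnegrE ?fnorm_ge0 // sqr_fnorm.
have -> : fdot (d^T *m B *m d) (d^T *m B *m d)
    = fdot (d *m d^T *m B) (d *m d^T *m B)^T.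
  rewrite /fdot !trmx_mul !trmxK Bsym.
  by rewrite !mulmxA mxtrace_mulC !mulmxA.
apply: le_trans (ler_norm _) _; apply: le_trans (fdot_le _ _) _.
by rewrite fnormT expr2.
Qed.

End FrameChange.

(** * The Newton step *)

Lemma epsS_gt0 (R : realType) : 0 < epsS :> R.
Proof. by rewrite /epsS invr_gt0 exprn_gt0. Qed.

Lemma epsS_le (R : realType) : epsS <= 1 / 500 :> R.
Proof.
rewrite /epsS -exprVn; lra.
Qed.

Lemma one_sub_sqr_le (R : realFieldType) (z : R) :
  199 / 200 <= z <= 201 / 200 -> `|1 - z ^+ 2| <= 1 / 50.
Proof.
move=> /andP[z0 z1]; have z_ge0 : 0 <= z by lra.
have := ler_wpM2r z_ge0 z0; have := ler_wpM2r z_ge0 z1.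
by rewrite ler_norml expr2 => zz1 zz0; apply/andP; split; lra.
Qed.

Section NewtonStep.
Context {R : realType} {n m : nat}.
Variables (C : 'M[R]_n) (A : 'I_m -> 'M[R]_n) (b : 'cV[R]_m).
Hypothesis n_gt0 : (0 < n)%N.
Hypothesis Asym : forall i, (A i)^T = A i.
Hypothesis Afree : free [tuple A i | i < m].

Lemma gradientE eta y :
  gradient C A b eta y = eta *: b - trace_vec A (invmx (slack C A y)).
Proof. by apply/colP => i; rewrite !mxE. Qed.

Lemma slackB y y' : slack C A y' - slack C A y = comb A (y' - y).
Proof. by rewrite combB /slack opprB addrA subrK. Qed.

Lemma gradient_dot eta y u V : is_frame V (slack C A y) ->
  ((gradient C A b eta y)^T *m u) 0 0
    = eta * (b^T *m u) 0 0 - fdot 1%:M (in_frame A V u).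
Proof.
move=> fr; rewrite gradientE linearB /= mulmxBl [LHS]mxE [X in _ + X]mxE.
rewrite trace_vec_dot (frame_inv fr) linearZ /= -scalemxAl mxE; congr (_ - _).
by rewrite /fdot in_frame_sym // mul1mx -mulmxA mxtrace_mulC.
Qed.

Variables (epsN eta : R) (y : 'cV[R]_m) (St V : 'M[R]_n) (lam : 'rV[R]_n).
Hypothesis eps_gt0 : 0 < epsN.
Hypothesis eps_le : epsN <= 1 / 100.
Hypothesis fr : is_frame V (slack C A y).
Hypothesis VStV : V^T *m St *m V = 1%:M + diag_mx lam.
Hypothesis lam_le : forall i, `|lam 0 i| <= epsS.
Hypothesis g_le : forall u,
  `|((gradient C A b eta y)^T *m u) 0 0| <= epsN * fnorm (in_frame A V u).

Let k := 1 + epsN / (20 * Num.sqrt n%:R).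
Let g := gradient C A b (eta * k) y.
Let w := - invmx (hessian A St) *m g.

(** Scaling [eta] by [k] turns the gradient into [k] times itself plus [k - 1] times the trace term.
    The latter is at most sqrt n times the norm, and (k - 1) sqrt n = epsN / 20. *)
Lemma scaled_gradient_le u :
  `|(g^T *m u) 0 0| <= 106 / 100 * epsN * fnorm (in_frame A V u).
Proof.
have -> : (g^T *m u) 0 0 = k * ((gradient C A b eta y)^T *m u) 0 0
    + (k - 1) * fdot 1%:M (in_frame A V u).
  by rewrite !(gradient_dot _ _ fr); ring.
have sn : 1 <= Num.sqrt n%:R :> R by rewrite -[leLHS]sqrtr1 ler_wsqrtr // ler1n.
have k1 : (k - 1) * Num.sqrt n%:R = epsN / 20.
  rewrite /k addrC addKr; field; rewrite gt_eqF // (lt_le_trans _ sn) //.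
have k0 : 0 <= k - 1.
  by rewrite /k addrC addKr divr_ge0 // ?mulr_ge0 // ltW // (lt_le_trans _ sn).
have k2 : k - 1 <= epsN / 20 by rewrite -k1 ler_peMr.
have B0 := fnorm_ge0 (in_frame A V u).
have := fdot_le 1%:M (in_frame A V u); rewrite fnorm1 => t_le.
apply: le_trans (ler_normD _ _) _; rewrite !normrM (ger0_norm k0).
rewrite [`|k|]ger0_norm; last by move: k0; rewrite subr_ge0; apply: le_trans.
have := ler_wpM2l k0 t_le; rewrite mulrA k1.
have : 0 <= k by lra.
move=> k0' /(le_trans _) h.
have := ler_wpM2l k0' (g_le u); move: B0 k2 eps_le eps_gt0.
set B := fnorm _; set a := `|(_ *m _) 0 0|; set c := _ * `|fdot _ _|.
have : c <= epsN / 20 * B by apply: h.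
clearbody k B a c; move=> cB B0 k2 e1 e0 ka.
have : k * (epsN * B) <= (1 + 1 / 2000) * (epsN * B).
  by rewrite ler_wpM2r ?mulr_ge0 ?(ltW e0) //; lra.
have : 0 <= epsN * B by rewrite mulr_ge0 // ltW.
lra.
Qed.

(** Scaling the columns of [V] by these factors gives a frame of [St]. The Hessian used by the
    Newton step is thus an entrywise rescaling, [scale_mx], away from the one at the true slack. *)
Let f i : R := (Num.sqrt (1 + lam 0 i))^-1.

Lemma scaling_sqr i : f i ^+ 2 * (1 + lam 0 i) = 1.
Proof.
have := lam_le i; rewrite /epsS ler_norml => /andP[l0 _].
have l1 : 0 < 1 + lam 0 i.
  have := epsS_le R; rewrite /epsS; lra.
by rewrite exprVn sqr_sqrtr ?ltW // mulVf // gt_eqF.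
Qed.

Lemma scaling_bounds i : 499 / 500 <= f i <= 501 / 500.
Proof.
have f0 : 0 <= f i by rewrite invr_ge0 sqrtr_ge0.
have := scaling_sqr i; have := le_trans (lam_le i) (epsS_le R); rewrite ler_norml.
move: (f i) (lam 0 i) f0 => z l z0 /andP[l0 l1]; rewrite expr2 => zz.
apply/andP; split; nra.
Qed.

Definition scale_mx (X : 'M[R]_n) : 'M[R]_n := \matrix_(i, j) (f i * f j * X i j).

Lemma scale_mxE X i j : scale_mx X i j = f i * f j * X i j.
Proof. by rewrite mxE. Qed.

Lemma scaled_frame : is_frame (V *m diag_mx (\row_i f i)) St.
Proof.
rewrite /is_frame trmx_mul tr_diag_mx !mulmxA -(mulmxA _ V^T) -(mulmxA _ _ V).
rewrite VStV; apply/matrixP => i j; rewrite mul_mx_diag mul_diag_mx !mxE.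
have [<-|ij] := eqVneq i j; last by rewrite addr0 mulr0 mul0r.
by rewrite !mulr1n mulrAC -expr2 scaling_sqr.
Qed.

Lemma in_scaled_frame u :
  in_frame A (V *m diag_mx (\row_i f i)) u = scale_mx (in_frame A V u).
Proof.
have -> : in_frame A (V *m diag_mx (\row_i f i)) u =
    diag_mx (\row_i f i) *m in_frame A V u *m diag_mx (\row_i f i).
  by rewrite /in_frame trmx_mul tr_diag_mx !mulmxA.
apply/matrixP => i j; rewrite mul_mx_diag mul_diag_mx !mxE.
by rewrite mulrAC.
Qed.

(** The linear system H(St) w = -g tested against [u], in the frame of [St]. *)
Lemma newton_equation u :
  (g^T *m u) 0 0 = - fdot (scale_mx (in_frame A V w)) (scale_mx (in_frame A V u)).
Proof.
have Hu := hessian_unit Asym Afree scaled_frame.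
have -> : g = - (hessian A St *m w).
  by rewrite /w mulNmx mulmxN opprK mulKVmx.
rewrite linearN /= mulNmx mxE trmx_mul (hessian_sym A).
by rewrite (hessian_frame Asym scaled_frame) !in_scaled_frame.
Qed.

Let X := in_frame A V w.

(** Testing the Newton equation at [u = w] bounds the squared norm of [scale_mx X] by 1.06 epsN |X|;
    the rescaling costs a factor 201/200 twice. *)
Lemma newton_decrement : fnorm X <= 108 / 100 * epsN.
Proof.
have XF : fnorm X <= 201 / 200 * fnorm (scale_mx X).
  apply: fnorm_le_entries => [|i j]; first lra.
  rewrite scale_mxE normrM -[leLHS]mul1r mulrA ler_wpM2r //.
  have /andP[i0 i1] := scaling_bounds i; have /andP[j0 j1] := scaling_bounds j.
  by rewrite ger0_norm; nra.
have := scaled_gradient_le w; rewrite newton_equation normrN -/X -sqr_fnorm.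
rewrite ger0_norm ?sqr_ge0 //.
move: XF (fnorm_ge0 X) (fnorm_ge0 (scale_mx X)) eps_gt0.
set N := fnorm (scale_mx X); set M := fnorm X => XF M0 N0 e0 NM.
have [N_eq0|N_neq0] := eqVneq N 0; first by move: XF; rewrite N_eq0; lra.
have Np : 0 < N by rewrite lt0r N_neq0.
have : N <= 106 / 100 * epsN * (201 / 200).
  rewrite -(ler_pM2r Np) -expr2; apply: le_trans NM _.
  by rewrite -(mulrA _ (201 / 200)) ler_wpM2l //; lra.
lra.
Qed.

Lemma newton_slack :
  V^T *m slack C A (y + w) *m V = 1%:M + X.
Proof.
have -> : slack C A (y + w) = slack C A y + comb A w.
  have := slackB y (y + w); rewrite (addrC y w) addrK => <-.
  by rewrite subrKC.
by rewrite mulmxDr mulmxDl fr.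
Qed.

(** Subtracting the Newton equation leaves the pairing of [in_frame A V u] with XJ - Y = (X - Y) -
    X(XJ). The part X - Y comes from using [St] in place of the slack and is at most |X| / 50; the
    rest is quadratic in |X|. Together they stay below epsN / 2, and the change of frame costs at
    most a factor 2. *)
Lemma newton_gradient_le V' u : is_frame V' (slack C A (y + w)) ->
  `|((gradient C A b (eta * k) (y + w))^T *m u) 0 0|
    <= epsN * fnorm (in_frame A V' u).
Proof.
move=> fr'; pose B := in_frame A V u; pose c := invmx V *m V'.
pose J := c *m c^T; pose Y := scale_mx (scale_mx X).
have Xle := newton_decrement.
have Xs : fnorm X <= 1 / 50 by move: Xle eps_le; set N := fnorm X; clearbody N; lra.
have -> : ((gradient C A b (eta * k) (y + w))^T *m u) 0 0
    = fdot (X *m J - Y) B.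
  rewrite (gradient_dot _ _ fr') fdotDl fdotNl.
  have -> : fdot Y B = - (g^T *m u) 0 0.
    rewrite newton_equation opprK !fdotE; do 2 (apply: eq_bigr => ? _).
    by rewrite !scale_mxE; ring.
  rewrite opprK (gradient_dot _ _ fr) -(frame_change_subJ fr fr' newton_slack).
  rewrite fdotDl fdotNl -/B.
  have -> : fdot 1%:M (in_frame A V' u) = fdot J B.
    have VcE : V *m c = V' := frame_change_mul V' fr.
    have -> : in_frame A V' u = c^T *m B *m c.
      by rewrite /B /in_frame -VcE trmx_mul !mulmxA.
    rewrite /fdot mul1mx (trmx_mul _ c) (trmx_mul _ B) trmxK mulmxA.
    by rewrite mxtrace_mulC mulmxA.
  by ring.
have B_le : fnorm B <= (1 + fnorm X) * fnorm (in_frame A V' u).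
  exact: (fnorm_frame_change fr' newton_slack (comb_sym Asym u)).
have XY : fnorm (X - Y) <= 1 / 50 * fnorm X.
  apply: fnorm_le_entries => [|i j]; first lra.
  rewrite [(X - Y) i j]mxE [(- Y) i j]mxE !scale_mxE.
  have -> : X i j - f i * f j * (f i * f j * X i j)
    = (1 - (f i * f j) ^+ 2) * X i j by ring.
  rewrite normrM ler_wpM2r //.
  have /andP[i0 i1] := scaling_bounds i; have /andP[j0 j1] := scaling_bounds j.
  have p0 : 199 / 200 <= f i * f j by nra.
  have p1 : f i * f j <= 201 / 200 by nra.
  by apply: one_sub_sqr_le; rewrite p0.
have XJY : fnorm (X *m J - Y) <= 1 / 50 * fnorm X + fnorm X * (26 / 25 * fnorm X).
  have -> : X *m J - Y = (X - Y) - X *m (X *m J).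
    rewrite -[in RHS](frame_change_subJ fr fr' newton_slack) mulmxBr mulmx1.
    by apply/esym; rewrite opprB addrC addrA subrK.
  apply: le_trans (fnormB _ _) _; rewrite lerD //.
  apply: le_trans (fnormM _ _) _; rewrite ler_wpM2l ?fnorm_ge0 //.
  exact: (fnorm_XJ fr fr' newton_slack Xs).
apply: le_trans (fdot_le _ _) _.
have X0 := fnorm_ge0 X; have B'0 := fnorm_ge0 (in_frame A V' u).
have D0 := fnorm_ge0 (X *m J - Y).
have B2 : fnorm B <= 2 * fnorm (in_frame A V' u).
  by apply: le_trans B_le _; rewrite ler_wpM2r //; lra.
have D2 : fnorm (X *m J - Y) <= epsN / 2 by nra.
apply: le_trans (ler_pM D0 (fnorm_ge0 B) D2 B2) _.
by rewrite mulrA divfK // pnatr_eq0.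
Qed.

End NewtonStep.

(** * Near doubly stochastic matrices *)

(* [al] and [be] form an optimal solution of the dual of the assignment problem
   with gains G i * N j. *)
Lemma near_doubly_stochastic_le (R : realDomainType) n (G N : nat -> R)
    (D : 'I_n -> 'I_n -> R) (p q : 'I_n -> R) :
    (forall i, 0 <= N i) ->
    {homo G : i j / (i <= j)%N >-> j <= i} ->
    {homo N : i j / (i <= j)%N >-> j <= i} -> G n = 0 ->
    (forall i j, 0 <= D i j) -> (forall i, 0 <= p i) -> (forall i, 0 <= q i) ->
    (forall i, \sum_j D i j <= 1 + p i) ->
    (forall j, \sum_i D i j <= 1 + q j) ->
  \sum_(i < n) \sum_(j < n) G i * N j * D i j <= \sum_(i < n) G i * N i * (1 + p i + q i).
Proof.
move=> N0 Gd Nd Gn D0 p0 q0 Dp Dq.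
pose al i := \sum_(i <= k < n) (G k - G k.+1) * N k.
pose be j := \sum_(j <= k < n) G k.+1 * (N k - N k.+1).
have al0 i : 0 <= al i.
  by apply: sumr_ge0 => k _; rewrite mulr_ge0 // subr_ge0 Gd.
have be0 j : 0 <= be j.
  rewrite /be big_nat; apply: sumr_ge0 => k /andP[_ kn].
  by rewrite mulr_ge0 ?subr_ge0 ?Nd // -Gn Gd.
(* Telescoping; [G n = 0] removes the boundary term. *)
have albe i : (i <= n)%N -> al i + be i = G i * N i.
  move=> i_n; rewrite /al /be -big_split /=.
  under eq_bigr => k _ do
    have -> : (G k - G k.+1) * N k + G k.+1 * (N k - N k.+1)
      = - (G k.+1 * N k.+1 - G k * N k) by ring.
  rewrite sumrN (telescope_sumr (fun k => G k * N k)) // Gn mul0r.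
  by rewrite sub0r opprK.
(* Dual feasibility. Between [i] and [j] one of the two factors is bounded by its value at an
   endpoint, and the other telescopes. *)
have key i j : (i <= n)%N -> (j <= n)%N -> G i * N j <= al i + be j.
  move=> i_n j_n; case: (leqP i j) => [ij|/ltnW ji].
    have : (G i - G j) * N j <= al i - al j.
      have -> : al i - al j = \sum_(i <= k < j) (G k - G k.+1) * N k.
        by rewrite /al (big_cat_nat ij j_n) /= addrK.
      rewrite -opprB -(telescope_sumr G) // -sumrN mulr_suml.
      rewrite !big_nat; apply: ler_sum => k /andP[_ kj].
      by rewrite opprB ler_wpM2l ?subr_ge0 ?Gd // Nd // ltnW.
    by have := albe j j_n; lra.
  have : G i * (N j - N i) <= be j - be i.
    have -> : be j - be i = \sum_(j <= k < i) G k.+1 * (N k - N k.+1).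
      by rewrite /be (big_cat_nat ji i_n) /= addrK.
    rewrite -opprB -(telescope_sumr N) // -sumrN mulr_sumr.
    rewrite !big_nat; apply: ler_sum => k /andP[_ ki].
    by rewrite opprB ler_wpM2r ?subr_ge0 ?Nd // Gd.
  by have := albe i i_n; lra.
apply: (@le_trans _ _ (\sum_(i < n) \sum_(j < n) (al i * D i j + be j * D i j))).
  apply: ler_sum => i _; apply: ler_sum => j _.
  by rewrite -mulrDl ler_wpM2r // key // ltnW.
under eq_bigr => i _ do rewrite big_split /=.
rewrite big_split /= [X in _ + X]exchange_big /= -big_split /=.
apply: ler_sum => i _; rewrite -!mulr_sumr -(albe i) ?(ltnW (ltn_ord i)) //.
have := ler_wpM2l (al0 i) (Dp i); have := ler_wpM2l (be0 i) (Dq i).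
have := mulr_ge0 (al0 i) (q0 i); have := mulr_ge0 (be0 i) (p0 i); nra.
Qed.

From mathcomp Require Import sequences zify.

(** * The cutoff of the spectrum *)

Section Coord.
Context {R : realType} {n : nat}.
Implicit Types (v : 'rV[R]_n).

Lemma coord1_ord v (i : 'I_n) : coord1 v i.+1 = v 0 i.
Proof.
by rewrite /coord1 (big_pred1 i) // => j; rewrite /= eqSS.
Qed.

Lemma coord1_out v k : (n < k)%N -> coord1 v k = 0.
Proof.
move=> nk; rewrite /coord1 big_pred0 // => i.
by rewrite ltn_eqF // (leq_ltn_trans (ltn_ord i)).
Qed.

(** The shift of the index matters: [coord1 v 0] is 0, which would break monotonicity. *)
Lemma coord1_noninc v : (forall i, 0 <= v 0 i) ->
    (forall i j : 'I_n, (i <= j)%N -> v 0 j <= v 0 i) ->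
  {homo (fun k => coord1 v k.+1) : i j / (i <= j)%N >-> j <= i}.
Proof.
move=> v0 vd i j ij; case: (ltnP j n) => jn; last first.
  rewrite (coord1_out _ (jn : (n < j.+1)%N)); case: (ltnP i n) => i_n.
    by rewrite (coord1_ord v (Ordinal i_n)).
  by rewrite coord1_out.
have i_n := leq_ltn_trans ij jn.
by rewrite (coord1_ord v (Ordinal jn)) (coord1_ord v (Ordinal i_n)) vd.
Qed.

End Coord.

Lemma filter_iota_head (P : pred nat) h r l :
    [seq k <- iota 1 h | P k] = r :: l ->
  [/\ P r, (1 <= r <= h)%N & forall k, (1 <= k < r)%N -> ~~ P k].
Proof.
move=> E; have : r \in [seq k <- iota 1 h | P k] by rewrite E mem_head.
rewrite mem_filter mem_iota add1n ltnS => /andP[Pr rh]; split=> // k /andP[k1 kr].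
apply/negP => Pk.
have : k \in [seq k <- iota 1 h | P k].
  rewrite mem_filter Pk mem_iota k1 add1n ltnS.
  by case/andP: rh => _; apply: leq_trans; apply: ltnW.
have : sorted ltn [seq k <- iota 1 h | P k].
  by apply: sorted_filter (iota_ltn_sorted _ _); apply: ltn_trans.
rewrite E /= => /(order_path_min ltn_trans) /allP rl.
rewrite inE => /orP[/eqP kr'|/rl]; first by rewrite kr' ltnn in kr.
by rewrite ltnNge ltnW.
Qed.

(** Induction on [j], from [k] to its half rounded up: then [r.*2] is at least [k], so a lower bound
    at [r.*2] passes to [k]. Each halving costs one factor [a], unless the value is already at least
    [e]. *)
Lemma halving_chain (R : realDomainType) (nu : nat -> R) (a e : R) j k :
    0 <= a <= 1 -> 0 <= e -> e <= nu 1%N ->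
    (forall i i', (1 <= i <= i')%N -> nu i' <= nu i) ->
    (1 <= k <= 2 ^ j)%N ->
    (forall r, (1 <= r < k)%N -> e <= nu r.*2 \/ a * nu r <= nu r.*2) ->
  a ^+ j * e <= nu k.
Proof.
move=> /andP[a0 a1] e0 e1 nud; elim: j k => [|j IH] k.
  rewrite expn0 => k1 _; have -> : k = 1%N by lia.
  by rewrite expr0 mul1r.
move=> /andP[k0 kj] fail.
have aj : a ^+ j.+1 * e <= e by rewrite ler_piMl // exprn_ile1.
have [k1|k1] := leqP k 1%N.
  have -> : k = 1%N by lia.
  exact: le_trans e1.
pose r := uphalf k.
have rk : (1 <= r < k)%N by rewrite /r; lia.
have k2r : (1 <= k <= r.*2)%N by rewrite /r; lia.
have rj : (1 <= r <= 2 ^ j)%N by move: kj; rewrite /r expnS; lia.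
have /(_ rj) IHr := IH r.
have {}IHr : a ^+ j * e <= nu r by apply: IHr => i ir; apply: fail; lia.
apply: le_trans (nud _ _ k2r); have [er|ar] := fail _ rk.
  exact: le_trans er.
by apply: le_trans ar; rewrite exprS -mulrA ler_wpM2l.
Qed.

(** * Numerical estimates of logarithms *)

(** From exp(-1/6) >= 5/6 one gets e <= (6/5)^6 < 3. Hence 1 - 1/ln n is positive for n >= 3. *)
Lemma ln3_gt1 (R : realType) : 1 < ln 3%:R :> R.
Proof.
rewrite -(ltr_expR (R := R)) lnK ?posrE //.
have : 5 / 6 <= expR (- (1 / 6)) :> R by have := expR_ge1Dx (- (1 / 6) : R); lra.
move=> h; have {h} : (5 / 6) ^+ 6 <= expR (- (1 / 6)) ^+ 6 :> R.
  by rewrite lerXn2r // nnegrE ?expR_ge0; lra.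
rewrite -expRM_natl; have -> : 6%:R * - (1 / 6) = - 1 :> R by lra.
rewrite expRN; move: (expR_gt0 (1 : R)); move: (expR 1) => e e0 h.
have : (5 / 6) ^+ 6 * e <= 1 by rewrite -[leRHS](mulVf (lt0r_neq0 e0)) ler_wpM2r // ltW.
by move: e0; lra.
Qed.

Lemma ln2_ge (R : realType) : 1 / 2 <= ln 2%:R :> R.
Proof.
rewrite -(ler_expR (R := R)) lnK ?posrE //.
have : 1 / 2 <= expR (- (1 / 2)) :> R by have := expR_ge1Dx (- (1 / 2) : R); lra.
rewrite expRN; move: (expR_gt0 (1 / 2 : R)); move: (expR _) => e e0 h.
have : 1 / 2 * e <= 1 by rewrite -[leRHS](mulVf (lt0r_neq0 e0)) ler_wpM2r // ltW.
by lra.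
Qed.

(* For L = ln n the exponent is at most 3 L, and 1 - 1/L >= exp (-1/(L-1)). *)
Lemma log_decay (R : realType) : exists c : R, 0 < c <= 1 /\
  forall n, (3 <= n)%N -> c <= (1 - (ln n%:R)^-1) ^+ up_log 2 n.
Proof.
have l3 := ln3_gt1 R; pose e := (ln 3%:R - 1)^-1 : R.
have e0 : 0 < e by rewrite invr_gt0 subr_gt0.
(* The total exponent 3 L / (L - 1) equals 3 + 3 / (L - 1), and L >= ln 3. *)
exists (expR (- (3 + 3 * e))); split; first by rewrite expR_gt0 expR_le1; lra.
move=> n n3; set L := ln n%:R.
have L3 : ln 3%:R <= L by rewrite ler_ln ?posrE ?ltr0n ?ler_nat //; lia.
have L1 : 0 < L - 1 by lra.
have jL : (up_log 2 n)%:R <= 3 * L.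
  have : (2 ^ (up_log 2 n).-1 < n)%N by apply: up_log_gtn; lia.
  have : (0 < up_log 2 n)%N by rewrite up_log_gt0; lia.
  case: (up_log 2 n) => // j _ /= /ltnW jn.
  have : j%:R * ln 2%:R <= L.
    rewrite mulr_natl -lnXn // ler_ln ?posrE ?exprn_gt0 ?ltr0n //; last by lia.
    by rewrite -natrX ler_nat.
  have := ln2_ge R; have := ler0n R j; rewrite -[j.+1]addn1 natrD; nra.
have base : expR (- (L - 1)^-1) <= 1 - L^-1.
  have L0 : 0 < L by lra.
  have h : L / (L - 1) <= expR ((L - 1)^-1).
    apply: le_trans (expR_ge1Dx _); rewrite le_eqVlt; apply/orP; left.
    by apply/eqP; field; rewrite gt_eqF.
  have -> : 1 - L^-1 = (L / (L - 1))^-1.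
    by field; rewrite !gt_eqF.
  by rewrite expRN lef_pV2 // posrE ?expR_gt0 // divr_gt0.
have pw : expR (- (L - 1)^-1) ^+ up_log 2 n <= (1 - L^-1) ^+ up_log 2 n.
  by rewrite lerXn2r // nnegrE ?expR_ge0 // (le_trans (expR_ge0 _) base).
apply: le_trans pw; rewrite -expRM_natl ler_expR mulrN lerN2.
have : (L - 1)^-1 <= e by rewrite lef_pV2 ?posrE //; lra.
have : (L - 1)^-1 * (L - 1) = 1 by rewrite mulVf // gt_eqF.
have : 0 < (L - 1)^-1 by rewrite invr_gt0.
move: (L - 1)^-1 => q q0 qL qe.
apply: le_trans (ler_wpM2r (ltW q0) jL) _; nra.
Qed.

Lemma sum_prefix_ge (R : realDomainType) n h (f : nat -> R) (x : R) :
    (h <= n)%N -> (forall i, 0 <= f i) -> (forall i, (i < h)%N -> x <= f i) ->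
  h%:R * x <= \sum_(i < n) f i.
Proof.
move=> hn f0 fx; rewrite -(big_mkord predT f) (big_cat_nat (leq0n h) hn) /=.
apply: ler_wpDr; first by apply: sumr_ge0.
rewrite big_mkord -[h in h%:R]card_ord mulr_natl -sumr_const.
by apply: ler_sum => i _; apply: fx.
Qed.

Section Drop.
Context {R : realType} {n : nat}.
Implicit Types (lam : 'rV[R]_n) (pi : 'S_n).

(** The local function [mu] of [cut_ok] under a name of its own. *)
Definition sorted_abs lam pi (k : nat) : R := `|coord1 (col_perm pi lam) k|.

Lemma sorted_abs_ord lam pi (i : 'I_n) :
  sorted_abs lam pi i.+1 = `|lam 0 (pi i)|.
Proof. by rewrite /sorted_abs coord1_ord mxE. Qed.

Lemma sorted_abs_out lam pi k : (n < k)%N -> sorted_abs lam pi k = 0.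
Proof. by move=> nk; rewrite /sorted_abs coord1_out ?normr0. Qed.

Lemma sorted_abs_noninc lam pi : decreasing_abs lam pi ->
  {homo (fun k => sorted_abs lam pi k.+1) : i j / (i <= j)%N >-> j <= i}.
Proof.
move=> dec; pose v : 'rV[R]_n := \row_i `|lam 0 (pi i)|.
have vE k : sorted_abs lam pi k.+1 = coord1 v k.+1.
  case: (ltnP k n) => kn; last by rewrite sorted_abs_out // coord1_out.
  rewrite (sorted_abs_ord lam pi (Ordinal kn)) (coord1_ord v (Ordinal kn)).
  by rewrite mxE.
move=> i j ij; rewrite !vE; apply: coord1_noninc ij => [k|k l kl]; rewrite !mxE //.
exact: dec.
Qed.

End Drop.

(** The sum on the right is the decrease of the potential caused by truncation, as
    [potential_truncate] shows. It is bounded below by its first half-rank many terms. *)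
Lemma update_rank_drop (R : realType) : exists c : R, 0 < c /\
  forall n (lam : 'rV[R]_n) (pi : 'S_n) (G : nat -> R),
    (2 <= n)%N -> decreasing_abs lam pi -> (forall k, 0 <= G k) ->
    {homo (fun k => G k.+1) : i j / (i <= j)%N >-> j <= i} ->
  let r := update_rank lam pi in
  c * (r%:R * G r) <= ln n%:R *
    \sum_(i < n) G i.+1 * (sorted_abs lam pi i.+1 - sorted_abs lam pi (i + r).+1).
Proof.
have [c0 [/andP[c0_gt0 c0_le1] c0P]] := log_decay R.
(* The 6 is needed at full rank: n <= 3 (n / 2) with the half rounded down, and ln n >= 1/2. *)
have e0 := epsS_gt0 R; exists (c0 * epsS / 6); split.
  by rewrite divr_gt0 ?mulr_gt0.
move=> n lam pi G n2 dec G0 Gd; set nu := sorted_abs lam pi; set L := ln n%:R.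
have nu0 k : 0 <= nu k by rewrite /nu /sorted_abs.
have nud i j : (1 <= i <= j)%N -> nu j <= nu i.
  by case: i j => [|i] [|j] //= ij; apply: sorted_abs_noninc.
have {}Gd i j : (1 <= i <= j)%N -> G j <= G i.
  by case: i j => [|i] [|j] //= ij; apply: Gd.
have L_ge : 1 / 2 <= L.
  apply: le_trans (ln2_ge R) _.
  by rewrite ler_ln ?posrE ?ltr0n ?ler_nat //; apply: leq_trans n2.
cbv zeta; rewrite /update_rank -/(sorted_abs lam pi 1) -/nu.
case: (lerP (nu 1%N) epsS) => [_|nu1].
  by rewrite mul0r mulr0 big1 ?mulr0 // => i _; rewrite addn0 subrr mulr0.
(* As long as no cutoff is found below [k], the [k]-th value is still a constant fraction of
   [epsS]. *)
have large k : (1 <= k <= n./2)%N ->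
    (forall r, (1 <= r < k)%N -> ~~ cut_ok lam pi r) -> c0 * epsS <= nu k.
  (* For n = 2 the factor 1 - 1/ln n is negative, but then only k = 1 is possible. *)
  move=> kn fail; have [n3|n_le2] := leqP 3 n; last first.
    have -> : k = 1%N by lia.
    by apply: le_trans (ltW nu1); rewrite ler_piMl // ltW.
  have L1 : 1 < L.
    apply: lt_le_trans (ln3_gt1 R) _.
    by rewrite ler_ln ?posrE ?ltr0n ?ler_nat //; apply: leq_trans n2.
  have a01 : 0 <= 1 - L^-1 <= 1.
    rewrite subr_ge0 gerBl invf_le1 ?invr_ge0; lra.
  apply: le_trans (ler_wpM2r (ltW e0) (c0P n n3)) _.
  apply: halving_chain => //; try exact: ltW.
    have := up_logP n (isT : (1 < 2)%N); lia.
  move=> r rk; have := fail r rk; rewrite /cut_ok -/(sorted_abs lam pi _).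
  rewrite -/(sorted_abs lam pi r) -/nu negb_and -!ltNge => /orP[] /ltW; auto.
have term0 r i : 0 <= G i.+1 * (nu i.+1 - nu (i + r).+1).
  by apply: mulr_ge0 => //; rewrite subr_ge0; apply: nud; lia.
(* Without a cutoff the rank is [n] and everything is annihilated, so each of the first [n./2] terms
   loses its whole value. *)
case E: [seq _ <- _ | _] => [|r l].
  have fail r : (1 <= r <= n./2)%N -> ~~ cut_ok lam pi r.
    move=> rn; apply/negP => ok.
    have : r \in [seq r <- iota 1 n./2 | cut_ok lam pi r].
      by rewrite mem_filter ok mem_iota add1n ltnS.
    by rewrite E.
  have hn : (1 <= n./2 <= n./2)%N by lia.
  have nuh : c0 * epsS <= nu n./2 by apply: large => // r rh; apply: fail; lia.
  have := @sum_prefix_ge _ n n./2 _ (G n * (c0 * epsS)) _ (term0 n) => h.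
  have {}h : (n./2)%:R * (G n * (c0 * epsS)) <=
      \sum_(i < n) G i.+1 * (nu i.+1 - nu (i + n).+1).
    apply: h => [|i ih]; first by lia.
    rewrite [nu (i + n).+1]sorted_abs_out ?subr0; last by lia.
    apply: ler_pM => //; first by rewrite mulr_ge0 // ltW.
      by apply: Gd; lia.
    by apply: le_trans nuh _; apply: nud; lia.
  have n3 : n%:R <= 3 * (n./2)%:R :> R by rewrite -natrM ler_nat; lia.
  have x0 : 0 <= G n * (c0 * epsS) by rewrite !mulr_ge0 // ltW.
  have s0 := le_trans (mulr_ge0 (ler0n R n./2) x0) h.
  have := ler_wpM2r s0 L_ge; have := ler_wpM2r x0 n3; lra.
have [/andP[_ cut] rn prev] := filter_iota_head E.
have nur : c0 * epsS <= nu r by apply: large rn prev.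
have := @sum_prefix_ge _ n r _ (G r.*2 * (nu r - nu r.*2)) _ (term0 r.*2) => h.
have cut' : nu r.*2 <= (1 - L^-1) * nu r by exact: cut.
have r2 : nu r.*2 <= nu r by apply: nud; move: rn; clear; lia.
have {}h : r%:R * (G r.*2 * (nu r - nu r.*2)) <=
      \sum_(i < n) G i.+1 * (nu i.+1 - nu (i + r.*2).+1).
  apply: h => [|i ir]; first by move: rn; clear; lia.
  apply: ler_pM => //; first by rewrite subr_ge0.
    by apply: Gd; move: ir; clear; lia.
  by apply: lerB; apply: nud; move: ir rn; clear; lia.
have L0 : 0 < L by lra.
(* The cutoff condition makes the gap at least a 1/L fraction of [nu r]; this is the source of the
   factor ln n. *)
have drop : c0 * epsS <= L * (nu r - nu r.*2).
  apply: le_trans nur _; have := ler_wpM2l (ltW L0) cut'.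
  by rewrite mulrA mulrBr mulr1 divff ?gt_eqF //; lra.
have rG : 0 <= r%:R * G r.*2 by rewrite mulr_ge0.
have := ler_wpM2l rG drop; have := ler_wpM2l (ltW L0) h.
have -> : (r.*2)%:R = 2 * r%:R :> R by rewrite -mul2n natrM.
set s := \sum_(i < n) _; move: (G r.*2) (nu r - nu r.*2) rG => x d rG h1 h2.
have ce : 0 <= r%:R * x * (c0 * epsS).
  by apply: mulr_ge0 => //; rewrite mulr_ge0 // ltW.
lra.
Qed.

(** * Variation of the potential *)

Section Potential.
Context {R : realType} {n : nat}.
Implicit Types (lam g : 'rV[R]_n) (pi tau : 'S_n).

Lemma l2norm_ge0 g : 0 <= l2norm g.
Proof. exact: sqrtr_ge0. Qed.

(** Cauchy-Schwarz, followed by the bound of the diagonal by the Frobenius norm. *)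
Lemma weighted_diag_le g (Y : 'M[R]_n) (s : 'S_n) :
  \sum_i g 0 i * `|Y (s i) (s i)| <= l2norm g * fnorm Y.
Proof.
apply: le_trans (ler_norm _) _.
rewrite -ler_sqr ?nnegrE ?mulr_ge0 ?l2norm_ge0 ?fnorm_ge0 //.
rewrite real_normK ?num_real // exprMn.
apply: le_trans (sum_cauchy_schwarz _ _) _.
rewrite /l2norm sqr_sqrtr; last by apply: sumr_ge0 => i _; apply: sqr_ge0.
apply: ler_wpM2l; first by apply: sumr_ge0 => i _; apply: sqr_ge0.
apply: le_trans (sum_diag_sqr Y).
rewrite [leRHS](reindex_perm s) /=; apply: ler_sum => i _.
by rewrite real_normK ?num_real.
Qed.

(** The potential Phi, provided that [pi] sorts [lam] by decreasing absolute value. *)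
Definition potential g lam pi : R :=
  \sum_(i < n) coord1 g i.+1 * sorted_abs lam pi i.+1.

Variable g : 'rV[R]_n.
Hypothesis g_ge0 : forall i, 0 <= g 0 i.
Hypothesis g_dec : forall i j : 'I_n, (i <= j)%N -> g 0 j <= g 0 i.

Lemma coord1_ge0 k : 0 <= coord1 g k.
Proof. by apply: sumr_ge0 => i _. Qed.

Lemma potential_ge0 lam pi : 0 <= potential g lam pi.
Proof. by apply: sumr_ge0 => i _; rewrite mulr_ge0 ?coord1_ge0 ?normr_ge0. Qed.

(* With c = V^-1 V', the new eigenvalues are
   lam'_i = \sum_j c_(j, i)^2 lam_j + (c^T c - 1)_(i, i), and the matrix of the
   c_(j, i)^2 is doubly stochastic up to the diagonals of c^T c - 1 and
   c c^T - 1. *)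
Lemma potential_rise (S S' St V V' X : 'M[R]_n) lam lam' tau pi :
    is_frame V S -> is_frame V' S' ->
    V^T *m S' *m V = 1%:M + X -> fnorm X <= 1 / 50 ->
    V^T *m St *m V = 1%:M + diag_mx lam ->
    V'^T *m St *m V' = 1%:M + diag_mx lam' ->
    (forall i, `|lam 0 i| <= epsS) ->
    decreasing_abs lam tau -> decreasing_abs lam' pi ->
  potential g lam' pi <= potential g lam tau + l2norm g.
Proof.
move=> fr fr' VSV X_le VStV V'StV' lam_le lam_dec lam'_dec.
pose c := invmx V *m V'.
have VcE : V *m c = V' := frame_change_mul V' fr.
pose E := c^T *m c - 1%:M; pose F := c *m c^T - 1%:M.
have E_le : fnorm E <= 11 / 500.
  have := fnorm_frame_gram fr fr' VSV X_le; rewrite -/c -/E; lra.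
have F_le : fnorm F <= 11 / 500 by rewrite /F fnorm_gram.
clearbody c.
have sum_row i : \sum_j c j i ^+ 2 = 1 + E i i.
  rewrite !mxE eqxx /= subrKC; apply: eq_bigr => j _.
  by rewrite mxE expr2.
have sum_col j : \sum_i c j i ^+ 2 = 1 + F j j.
  rewrite !mxE eqxx /= subrKC; apply: eq_bigr => i _.
  by rewrite mxE expr2.
have lam'E i : lam' 0 i = \sum_j c j i ^+ 2 * lam 0 j + E i i.
  have := V'StV'; rewrite -VcE trmx_mul.
  have -> : c^T *m V^T *m St *m (V *m c) = c^T *m (V^T *m St *m V) *m c.
    by rewrite !mulmxA.
  rewrite VStV mulmxDr mulmx1 mulmxDl => /matrixP/(_ i i) h.
  have := sum_row i; rewrite !mxE eqxx mulr1n /= in h *.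
  have -> : \sum_j c j i ^+ 2 * lam 0 j
      = \sum_j (c^T *m diag_mx lam) i j * c j i.
    by apply: eq_bigr => j _; rewrite mul_mx_diag !mxE expr2; ring.
  by move: h => /eqP; lra.
pose G k := coord1 g k.+1; pose N k := sorted_abs lam tau k.+1.
(* Both indices are put in sorted order, so that the rearrangement bound applies. *)
pose D (i j : 'I_n) := c (tau j) (pi i) ^+ 2.
have Gi (i : 'I_n) : G i = g 0 i by apply: coord1_ord.
have N_le (i : 'I_n) : 0 <= N i <= 1.
  rewrite /N sorted_abs_ord normr_ge0 (le_trans (lam_le _)) //.
  by have := epsS_le R; lra.
have main : \sum_(i < n) \sum_(j < n) G i * N j * D i j
    <= \sum_(i < n) G i * N i *
         (1 + `|E (pi i) (pi i)| + `|F (tau i) (tau i)|).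
  apply: (near_doubly_stochastic_le (p := fun i => `|E (pi i) (pi i)|)
    (q := fun i => `|F (tau i) (tau i)|)) => //.
  - by move=> i; apply: normr_ge0.
  - exact: coord1_noninc.
  - exact: sorted_abs_noninc.
  - exact: coord1_out.
  - by move=> i j; apply: sqr_ge0.
  - move=> i; apply: (@le_trans _ _ (1 + E (pi i) (pi i))).
      by rewrite -sum_row [leRHS](reindex_perm tau).
    by rewrite lerD2l ler_norm.
  - move=> j; apply: (@le_trans _ _ (1 + F (tau j) (tau j))).
      by rewrite -sum_col [leRHS](reindex_perm pi).
    by rewrite lerD2l ler_norm.
have -> : potential g lam' pi = \sum_(i < n) G i * `|lam' 0 (pi i)|.
  by apply: eq_bigr => i _; rewrite sorted_abs_ord.
have step1 : \sum_(i < n) G i * `|lam' 0 (pi i)| <=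
    \sum_(i < n) \sum_(j < n) G i * N j * D i j
    + \sum_i g 0 i * `|E (pi i) (pi i)|.
  rewrite -big_split /=; apply: ler_sum => i _; rewrite lam'E -Gi.
  have -> : \sum_(j < n) G i * N j * D i j
      = G i * \sum_j c j (pi i) ^+ 2 * `|lam 0 j|.
    rewrite [in RHS](reindex_perm tau) /= mulr_sumr; apply: eq_bigr => j _.
    by rewrite /N sorted_abs_ord /D; ring.
  rewrite -mulrDr ler_wpM2l ?coord1_ge0 //.
  apply: le_trans (ler_normD _ _) _; rewrite lerD2r.
  apply: le_trans (ler_norm_sum _ _ _) _; apply: ler_sum => j _.
  by rewrite normrM ger0_norm ?sqr_ge0.
have step2 : \sum_(i < n) G i * N i *
      (1 + `|E (pi i) (pi i)| + `|F (tau i) (tau i)|)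
    <= potential g lam tau + \sum_i g 0 i * `|E (pi i) (pi i)|
       + \sum_i g 0 i * `|F (tau i) (tau i)|.
  rewrite -!big_split /=; apply: ler_sum => i _.
  rewrite -/(G i) -/(N i) -Gi.
  have /andP[N0 N1] := N_le i.
  rewrite !mulrDr mulr1 -!addrA lerD2l.
  by apply: lerD; rewrite ler_wpM2r ?ler_piMr ?coord1_ge0.
(* The errors are two terms in [E] and one in [F], in total at most 33/500 of the norm of [g]. *)
have := weighted_diag_le g E pi; have := weighted_diag_le g F tau.
have := ler_wpM2l (l2norm_ge0 g) E_le; have := ler_wpM2l (l2norm_ge0 g) F_le.
have := l2norm_ge0 g; lra.
Qed.

End Potential.

(** * Truncation of the spectrum *)

Section Truncation.
Context {R : realType} {n : nat} (lam : 'rV[R]_n) (pi : 'S_n).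
Hypothesis n_gt0 : (0 < n)%N.
Hypothesis lam_dec : decreasing_abs lam pi.

Lemma rot_ord_inj r :
  injective (fun i : 'I_n => Ordinal (ltn_pmod (i + r) n_gt0)).
Proof.
move=> i j /(congr1 val) /= /eqP; rewrite eqn_modDr !modn_small // => /eqP.
exact: val_inj.
Qed.

(* The truncated spectrum is sorted by the cyclic shift by r, which sends the
   r annihilated positions to the end. *)
Definition shifted_perm r : 'S_n := (perm (@rot_ord_inj r) * pi)%g.

(** Position [i + r] keeps its eigenvalue; a shift that wraps around lands among the [r] annihilated
    positions, and [sorted_abs] is 0 beyond [n]. *)
Lemma truncate_sorted r (i : 'I_n) : (r <= n)%N ->
  `|truncate_spectrum lam pi r 0 (shifted_perm r i)| = sorted_abs lam pi (i + r).+1.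
Proof.
move=> rn; rewrite /shifted_perm mxE permM permK permE; set k := Ordinal _.
have : nat_of_ord k = ((i + r) %% n)%N by []; move: k => k kE.
have [irn|irn] := ltnP (i + r) n.
  move: kE; rewrite modn_small // => kE.
  by rewrite kE ltnNge leq_addl /= -kE sorted_abs_ord.
have ir := ltn_ord i.
have ks : (k < r)%N.
  have irE : (i + r = (i + r - n) + n)%N by lia.
  by rewrite kE irE modnDr modn_small; lia.
by rewrite sorted_abs_out // ks normr0.
Qed.

Lemma truncate_decreasing r : (r <= n)%N ->
  decreasing_abs (truncate_spectrum lam pi r) (shifted_perm r).
Proof.
move=> rn i j ij; rewrite !truncate_sorted //.
by apply: (sorted_abs_noninc lam_dec); rewrite leq_add2r.
Qed.

Lemma update_rank_le : (update_rank lam pi <= n)%N.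
Proof.
rewrite /update_rank; case: ifP => // _.
case E: [seq _ <- _ | _] => [|r l] //.
have [_ rn _] := filter_iota_head E; lia.
Qed.

(** This restores the closeness of the approximate slack. The surviving values lie beyond the
    cutoff, where the first condition of [cut_ok] bounds them; ranks 0 and [n] are immediate. *)
Lemma truncate_small (i : 'I_n) :
  `|truncate_spectrum lam pi (update_rank lam pi) 0 i| <= epsS.
Proof.
set r := update_rank lam pi.
have [inv _ invK] := injF_bij (@perm_inj _ (shifted_perm r)).
rewrite -(invK i) truncate_sorted ?update_rank_le //; move: (inv i) => k.
have noninc a b : (1 <= a <= b)%N -> sorted_abs lam pi b <= sorted_abs lam pi a.
  by case: a b => [|a] [|b] //= ab; apply: sorted_abs_noninc.
rewrite /r /update_rank -/(sorted_abs lam pi 1).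
case: (lerP (sorted_abs lam pi 1) epsS) => [nu1|_].
  by apply: le_trans nu1; apply: noninc; lia.
case E: [seq _ <- _ | _] => [|j l].
  by rewrite sorted_abs_out ?ltW ?epsS_gt0 //; lia.
have [/andP[cut _] jn _] := filter_iota_head E.
by apply: le_trans cut; apply: noninc; lia.
Qed.

Lemma potential_truncate g r : (r <= n)%N ->
  potential g lam pi
    - potential g (truncate_spectrum lam pi r) (shifted_perm r)
  = \sum_(i < n) coord1 g i.+1 *
      (sorted_abs lam pi i.+1 - sorted_abs lam pi (i + r).+1).
Proof.
move=> rn; rewrite -sumrB; apply: eq_bigr => i _.
by rewrite -mulrBr; congr (_ * (_ - _)); rewrite sorted_abs_ord truncate_sorted.
Qed.

End Truncation.

(** * Amortization *)

Section Run.
Context {R : realType} {n m : nat}.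
Variables (C : 'M[R]_n) (A : 'I_m -> 'M[R]_n) (b : 'cV[R]_m) (epsN : R).
Hypothesis n_ge2 : (2 <= n)%N.
Hypothesis Asym : forall i, (A i)^T = A i.
Hypothesis Afree : free [tuple A i | i < m].
Hypothesis epsN_gt0 : 0 < epsN.
Hypothesis epsN_le : epsN <= 1 / 100.
Variable g : 'rV[R]_n.
Hypothesis g_ge0 : forall i, 0 <= g 0 i.
Hypothesis g_dec : forall i j : 'I_n, (i <= j)%N -> g 0 j <= g 0 i.

(** The frame is existential because each update brings its own diagonalizing basis. *)
Definition ipm_invariant (s : ipm_state n m) (phi : R) : Prop :=
  exists (V : 'M[R]_n) (lam : 'rV[R]_n) (tau : 'S_n),
    [/\ is_frame V (slack C A (st_y s)),
        V^T *m st_Stilde s *m V = 1%:M + diag_mx lam,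
        (forall i, `|lam 0 i| <= epsS) /\ decreasing_abs lam tau,
        forall u, `|((gradient C A b (st_eta s) (st_y s))^T *m u) 0 0|
          <= epsN * fnorm (in_frame A V u) &
        phi = potential g lam tau].

(** The approximate slack starts exact, so the spectrum and the potential are 0. *)
Lemma ipm_invariant_init s : ipm_init C A b epsN s -> ipm_invariant s 0.
Proof.
move=> [_ Spd g_le _ StE]; have [Spsd Su] := posdef_psd_unit Spd.
have I1 : 1%:M *m (1%:M)^T = 1%:M :> 'M[R]_n by rewrite trmx1 mulmx1.
have [_ _ fr] := sqrtmx_frame Spsd Su I1.
exists (invmx (sqrtmx (slack C A (st_y s))) *m 1%:M), 0, 1%g; split.
- exact: fr.
- rewrite StE fr; have -> : diag_mx 0 = 0 :> 'M[R]_n by exact: linear0.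
  by rewrite addr0.
- split=> [i|i j _]; first by rewrite mxE normr0 ltW ?epsS_gt0.
  by rewrite !mxE normr0.
- move=> u; apply: (hessian_dual_norm Asym Afree fr _ g_le); exact: ltW.
- rewrite /potential big1 // => i _.
  by rewrite sorted_abs_ord mxE normr0 mulr0.
Qed.

(** The move of the slack raises the potential by at most the norm of [g], and the truncation then
    lowers it in proportion to the rank term. The hypothesis is [update_rank_drop] at the given
    size. *)
Lemma ipm_invariant_step (c : R) s s' r phi :
    (forall (lam : 'rV[R]_n) (pi : 'S_n) (G : nat -> R),
      decreasing_abs lam pi -> (forall k, 0 <= G k) ->
      {homo (fun k => G k.+1) : i j / (i <= j)%N >-> j <= i} ->
      let r := update_rank lam pi in
      c * (r%:R * G r) <= ln n%:R *
        \sum_(i < n) G i.+1 *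
          (sorted_abs lam pi i.+1 - sorted_abs lam pi (i + r).+1)) ->
    ipm_step C A b epsN s r s' -> ipm_invariant s phi ->
  exists phi', ipm_invariant s' phi' /\
    c * (r%:R * coord1 g r) <= ln n%:R * (phi + l2norm g - phi').
Proof.
have n_gt0 : (0 < n)%N by apply: leq_trans n_ge2.
move=> drop [etaE yE SE [U [lam1 [pi [UU ZE lam1_dec rE StE]]]]].
move=> [V [lam [tau [fr VStV [lam_le lam_dec] g_le phiE]]]].
have Xle := newton_decrement n_gt0 Asym Afree epsN_gt0 epsN_le fr VStV lam_le g_le.
have VSV := newton_slack b epsN (st_eta s) (st_Stilde s) fr.
have grad' := newton_gradient_le n_gt0 Asym Afree epsN_gt0 epsN_le fr VStV
  lam_le g_le.
rewrite mulNmx -etaE -yE in Xle VSV grad'.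
set X := in_frame A V _ in Xle VSV.
have Xsym : X^T = X by apply: in_frame_sym.
have X_le : fnorm X <= 1 / 50 by apply: le_trans Xle _; move: epsN_le; lra.
have X1 : fnorm X < 1 by apply: le_lt_trans X_le _; lra.
have [Spsd Su] := psd_congr (frame_unit fr) VSV Xsym X1.
rewrite SE in ZE StE.
have [Psym Pu fr'] := sqrtmx_frame Spsd Su UU.
(* [U] diagonalizes the matrix [Zmid] of the update, so this frame of the new slack diagonalizes the
   approximate slack both before and after truncation. *)
set P := sqrtmx _ in ZE StE Psym Pu fr'; set V' := _ *m U in fr'.
have UtU : U^T *m U = 1%:M by apply: mulmx1C.
have V'StV' : V'^T *m st_Stilde s *m V' = 1%:M + diag_mx lam1.
  rewrite /V' trmx_mul trmx_inv Psym.
  have -> : U^T *m invmx P *m st_Stilde s *m (invmx P *m U)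
      = U^T *m (invmx P *m st_Stilde s *m invmx P) *m U by rewrite !mulmxA.
  have -> : invmx P *m st_Stilde s *m invmx P
      = 1%:M + U *m diag_mx lam1 *m U^T by rewrite -ZE subrKC.
  rewrite mulmxDr mulmx1 mulmxDl UtU !mulmxA UtU mul1mx.
  by rewrite -mulmxA UtU mulmx1.
pose lam2 := truncate_spectrum lam1 pi r.
have V'St'V' : V'^T *m st_Stilde s' *m V' = 1%:M + diag_mx lam2.
  rewrite StE mulmxDr mulmxDl V'StV' -addrA; congr (_ + _).
  have PV' : P *m V' = U by rewrite mulKVmx.
  have V'P : V'^T *m P = U^T by rewrite -{1}Psym -trmx_mul PV'.
  rewrite !mulmxA V'P UtU mul1mx -!mulmxA PV' UtU mulmx1.
  by rewrite linearB /= subrKC.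
have rn : (r <= n)%N by rewrite rE update_rank_le.
exists (potential g lam2 (shifted_perm pi n_gt0 r)); split.
  exists V', lam2, (shifted_perm pi n_gt0 r); split=> //.
  - split; first by rewrite /lam2 rE; apply: truncate_small.
    exact: truncate_decreasing.
  - by move=> u; apply: grad'.
have rise := potential_rise g_ge0 g_dec fr fr' VSV X_le VStV V'StV' lam_le
  lam_dec lam1_dec.
have := drop lam1 pi (coord1 g) lam1_dec (coord1_ge0 g_ge0) (coord1_noninc g_ge0 g_dec).
cbv zeta; rewrite -rE -(potential_truncate lam1 pi n_gt0 g rn) => /le_trans; apply.
rewrite ler_wpM2l ?lerD2r ?phiE //.
by rewrite ln_ge0 // ler1n.
Qed.

End Run.

Theorem theorem10p8 (R : realType) :
  exists K : R, 0 < K /\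
  forall (n m : nat) (C : 'M[R]_n) (A : 'I_m -> 'M[R]_n) (b : 'cV[R]_m)
    (epsN eps : R) (s : nat -> ipm_state (R:=R) n m) (r : nat -> nat),
    (2 <= n)%N ->
    C^T = C ->
    (forall i, (A i)^T = A i) ->
    free [tuple A i | i < m] ->
    0 < epsN <= 1 / 100 ->
    0 < eps <= 1 / 100 ->
    let T := ipm_iterations n epsN eps in
    ipm_run C A b epsN T s r ->
    forall g : 'rV[R]_n,
      (forall i, 0 <= g 0 i) ->
      (forall i j : 'I_n, (i <= j)%N -> g 0 j <= g 0 i) ->
      \sum_(1 <= t < T.+1) (r t)%:R * coord1 g (r t)
        <= K * (T%:R * l2norm g * ln n%:R).
Proof.
have [c [c0 drop]] := update_rank_drop R.
exists c^-1; split; first by rewrite invr_gt0.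
move=> n m C A b epsN eps s r n2 _ Asym Afree /andP[e0 e1] _ T [init step] g g0 gd.
have L0 : 0 <= ln n%:R :> R by rewrite ln_ge0 // ler1n; lia.
(* Amortization: the current potential is subtracted from the budget, so the rise and drop of each
   iteration telescope. *)
have inv t : (t <= T)%N -> exists phi, [/\ ipm_invariant C A b epsN g (s t) phi,
    0 <= phi &
    c * \sum_(1 <= i < t.+1) (r i)%:R * coord1 g (r i)
      <= ln n%:R * (t%:R * l2norm g - phi)].
  elim: t => [|t IH] tT.
    exists 0; split=> //; first exact: ipm_invariant_init.
    by rewrite big_geq // mulr0 mul0r subrr mulr0.
  have [phi [inv_t phi0 sum_t]] := IH (ltnW tT).
  have [phi' [inv_t' le_t]] := ipm_invariant_step n2 Asym Afree e0 e1 g0 gd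
    (fun lam pi G => drop n lam pi G n2) (step t tT) inv_t.
  exists phi'; split=> //.
    by have [V [lam [tau [_ _ _ _ ->]]]] := inv_t'; apply: potential_ge0.
  rewrite big_nat_recr //= mulrDr -natr1.
  by apply: le_trans (lerD sum_t le_t) _; rewrite -mulrDr ler_wpM2l //; lra.
have [phi [_ phi0 sum_T]] := inv T (leqnn T).
rewrite mulrC ler_pdivlMr // mulrC; apply: le_trans sum_T _.
by rewrite mulrC ler_wpM2r // gerBl.
Qed.
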